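(* Let $Y$ be a normed space, $L:Y\rightrightarrows Y$, $L^\circ(y):=L(y)\setminus\{y\}$ for $y\in Y$, and $\bar y\in Y$. Consider the following properties: (O1) $\liminf_{L^\circ(\bar y)\ni y\to\bar y}d(\bar y,L(y))=0$; (O2) $\bar y\in\mathrm{cl}\,L^\circ(\bar y)$; (O3) $\bar y\notin L(\bar y)$; (O4) $y\in\mathrm{cl}\,L(y)$ for all $y$ near $\bar y$; (O5) if $y\in L^\circ(\bar y)$ and $v\in\mathrm{cl}\,L(y)$, then $v\in L^\circ(\bar y)$; (O6) if $y\in L(\bar y)$ and $v\in\mathrm{cl}\,L(y)$, then $v\in L(\bar y)$. The following assertions hold true. (i) (O1) $\Leftrightarrow$ $\{y\in Y\mid d(\bar y,L(y))<\varepsilon\}\cap L^\circ(\bar y)\cap B_\varepsilon(\bar y)\ne\emptyset$ for all $\varepsilon>0$. (ii) (O1) $\Rightarrow$ (O2). (iii) (O3) $\Leftrightarrow$ $[L(\bar y)=L^\circ(\bar y)]$. (iv) (O2) and (O4) $\Rightarrow$ (O1). (v) (O3) and (O4) $\Rightarrow$ (O2). (vi) (O3) $\Rightarrow$ [(O5) $\Leftrightarrow$ (O6)].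
   Context: $B_\varepsilon(\bar y)$ is the open ball; $d(y,S)=\inf_{u\in S}\|u-y\|$ with $d(y,\emptyset)=+\infty$; $\mathrm{cl}$ is the closure; set-valued mappings may have empty values. In (O1), the lower limit is $\lim_{\varepsilon\downarrow0}\inf\{d(\bar y,L(y))\mid y\in L^\circ(\bar y)\cap B_\varepsilon(\bar y)\}$, with $\inf\emptyset=+\infty$. *)

(* Defs.v *)
From HB Require Import structures.
From mathcomp Require Import all_boot all_order all_algebra.
From mathcomp Require Import all_classical all_reals all_analysis.
Set Implicit Arguments.
Unset Strict Implicit.
Unset Printing Implicit Defensive.
Import Order.TTheory GRing.Theory Num.Theory.
Import numFieldNormedType.Exports.
Local Open Scope classical_set_scope.
Local Open Scope ring_scope.

Section SetValuedMapping.
Context {R : realType} {Y : normedModType R}.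

(* Extended-real-valued, so that the distance to the empty set is +oo. *)
Definition dist_set (y : Y) (S : set Y) : \bar R :=
  ereal_inf [set (`|u - y|)%:E | u in S].

Definition punctured (L : Y -> set Y) (y : Y) : set Y := L y `\ y.

(* The limit always exists in \bar R, as the infimum is nonincreasing in eps;
   convergence to 0 therefore says that the lower limit is 0. *)
Definition O1 (L : Y -> set Y) (ybar : Y) : Prop :=
  ereal_inf [set dist_set ybar (L y) | y in punctured L ybar `&` ball ybar eps]
    @[eps --> (0 : R)^'+] --> 0%E.

Definition O2 (L : Y -> set Y) (ybar : Y) : Prop :=
  closure (punctured L ybar) ybar.

Definition O3 (L : Y -> set Y) (ybar : Y) : Prop := ~ L ybar ybar.

Definition O4 (L : Y -> set Y) (ybar : Y) : Prop :=
  \forall y \near ybar, closure (L y) y.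

Definition O5 (L : Y -> set Y) (ybar : Y) : Prop :=
  forall y v : Y, punctured L ybar y -> closure (L y) v -> punctured L ybar v.

Definition O6 (L : Y -> set Y) (ybar : Y) : Prop :=
  forall y v : Y, L ybar y -> closure (L y) v -> L ybar v.

End SetValuedMapping.

(* Main.v *)
Require Import Defs.
From HB Require Import structures.
From mathcomp Require Import all_boot all_order all_algebra.
From mathcomp Require Import all_classical all_reals all_analysis.
Import Order.TTheory GRing.Theory Num.Theory.
Import numFieldNormedType.Exports.
Local Open Scope classical_set_scope.
Local Open Scope ring_scope.

(** Everything rests on the epsilon form [O1P] of (O1). The infimum over a punctured ball is
    nonnegative, and it lies below a given bound exactly when a single point of the ball has a
    distance below it, so convergence to 0 amounts to having such points at every scale. Forgetting
    the distance condition leaves (O2); conversely, (O4) recovers that condition by the triangle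
    inequality. Under (O3) puncturing changes nothing, so (O2) is (O4) read at the base point, and
    (O5) is literally (O6). *)

Section Proposition.
Context {R : realType} {Y : normedModType R}.
Implicit Types (L : Y -> set Y) (S : set Y) (y : Y).

Lemma dist_set_ge0 y S : (0 <= dist_set y S)%E.
Proof. by apply/le_ereal_inf_tmp => _ [u _ <-]; rewrite lee_fin. Qed.

Lemma dist_set_le y S u : S u -> (dist_set y S <= `|u - y|%:E)%E.
Proof. by move=> Su; apply: ereal_inf_lbound; exists u. Qed.

Lemma O1P L y :
  O1 L y <-> forall eps : R, 0 < eps ->
    [set z | (dist_set y (L z) < eps%:E)%E]
      `&` punctured L y `&` ball y eps !=set0.
Proof.
split=> [L0 e e0|H].
- have /L0/= inf_lt : nbhs (0%E : \bar R) [set x | (x < e%:E)%E].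
    apply: open_nbhs_nbhs; split; first exact: open_ereal_lt_ereal.
    by rewrite /= lte_fin.
  (* The limit controls the infimum only at small radii, hence an auxiliary [r]; with [r < e], a
     witness in the [r]-ball also lies in the [e]-ball. *)
  have /filter_ex[r [re inf_re]] : \forall r \near (0 : R)^'+, r < e /\
      (ereal_inf [set dist_set y (L z) | z in punctured L y `&` ball y r]
        < e%:E)%E.
    by apply: filterI; [exact: nbhs_right_lt|exact: inf_lt].
  have [_ [z [Lz yz] <-] dz] := ereal_inf_lt inf_re.
  by exists z; split=> //; apply: le_ball yz; exact: ltW.
(* Squeeze: the witness supplied by [H e] bounds the infimum at radius [e] by [e] itself. *)
- suff inf_le : \forall e \near (0 : R)^'+, (0 <= ereal_inf
      [set dist_set y (L z) | z in punctured L y `&` ball y e] <= e%:E)%E.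
    apply: (squeeze_cvge inf_le); first exact: cvg_cst.
    by apply: cvg_EFin; [exact: nearW|exact: cvg_at_right_filter].
  near=> e; have [|z [[/= dz Lz] yz]] := H e.
    by near: e; exact: nbhs_right_gt.
  apply/andP; split.
  + by apply/le_ereal_inf_tmp => _ [u _ <-]; exact: dist_set_ge0.
  + by apply: le_trans (ltW dz); apply: ereal_inf_lbound; exists z.
Unshelve. all: by end_near.
Qed.

Lemma O1_O2 L y : O1 L y -> O2 L y.
Proof.
move=> /O1P H B /nbhs_ballP[e /= e0 yB].
by have [z [[_ Lz] yz]] := H _ e0; exists z; split=> //; exact: yB.
Qed.

Lemma O3P L y : O3 L y <-> L y = punctured L y.
Proof.
rewrite /O3 /punctured; split=> [Ly|->]; last by case=> _; apply.
by rewrite not_setD1.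
Qed.

Lemma O2_O4_O1 L y : O2 L y -> O4 L y -> O1 L y.
Proof.
move=> Ly clL; apply/O1P => e e0.
(* Two hops of length [e / 2]: from [y] to [z] by (O2), then from [z] to some [u] in [L z] by
   (O4). *)
have e2 : 0 < e / 2 by rewrite divr_gt0.
(* (O4) holds only near [y], so [z] is sought in the ball intersected with the neighbourhood where
   it holds. *)
have [z [Lz [clz yz]]] := Ly _ (filterI clL (nbhsx_ballx y _ e2)).
have [u [Lu zu]] := clz _ (nbhsx_ballx z _ e2).
exists z; split; last first.
  by apply: le_ball yz; rewrite ler_pdivrMr// ler_peMr ?ler1n// ltW.
split=> //=; apply: le_lt_trans (dist_set_le _ _ _ Lu) _.
rewrite lte_fin distrC; have := ball_triangle yz zu.
by rewrite -splitr -ball_normE.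
Qed.

Lemma O3_O4_O2 L y : O3 L y -> O4 L y -> O2 L y.
Proof. by rewrite /O2 => /O3P <- /nbhs_singleton. Qed.

Lemma O3_O5_O6 L y : O3 L y -> (O5 L y <-> O6 L y).
Proof. by rewrite /O5 /O6 => /O3P <-. Qed.

End Proposition.

Theorem proposition4p1 (R : realType) (Y : normedModType R)
    (L : Y -> set Y) (ybar : Y) :
  (O1 L ybar <->
     forall eps : R, 0 < eps ->
       [set y | (dist_set ybar (L y) < eps%:E)%E]
         `&` punctured L ybar `&` ball ybar eps !=set0) /\
  (O1 L ybar -> O2 L ybar) /\
  (O3 L ybar <-> L ybar = punctured L ybar) /\
  (O2 L ybar /\ O4 L ybar -> O1 L ybar) /\
  (O3 L ybar /\ O4 L ybar -> O2 L ybar) /\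
  (O3 L ybar -> (O5 L ybar <-> O6 L ybar)).
Proof.
split; first exact: O1P.
split; first exact: O1_O2.
split; first exact: O3P.
split; first by case; exact: O2_O4_O1.
split; first by case; exact: O3_O4_O2.
exact: O3_O5_O6.
Qed.
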